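(* Let $p$ be a prime number, and let $q\ge 0$ and $n\ge 1$ be integers. Then $$S_{p}^{(q)}(n)\equiv\binom{n+q+1}{q+2}\pmod p.$$
   Context: The hyper-sums of powers of integers are defined by $S_p^{(0)}(n)=S_p(n)=1^p+2^p+\cdots+n^p$ and $S_{p}^{(q)}(n)=\sum_{k=1}^{n}S_{p}^{(q-1)}(k)$ for $q\ge 1$. *)

(* Defs.v *)
From mathcomp Require Import all_boot.

Set Implicit Arguments.
Unset Strict Implicit.
Unset Printing Implicit Defensive.

(* [hyper_sum p q n] is S_p^{(q)}(n). *)
Fixpoint hyper_sum (p q n : nat) : nat :=
  if q is q'.+1 then \sum_(1 <= k < n.+1) hyper_sum p q' k
  else \sum_(1 <= k < n.+1) k ^ p.

(* Main.v *)
(* By Fermat's little theorem the k ^ p may be replaced by k modulo p, and the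
   hyper-sums of k = 'C(k, 1) satisfy Pascal's recurrence. *)
Require Import Defs.
From mathcomp Require Import all_boot.

Theorem theorem15 (p q n : nat) (hp : prime p) (hn : 1 <= n) :
  hyper_sum p q n = 'C(n + q + 1, q + 2) %[mod p].
Proof.
(* [hn] is dropped so that the induction on [n] can start at the empty sum [n = 0], where the
   binomial vanishes as well. [IHq] stays general in [n]. *)
rewrite addn1 addn2; elim: q n {hn} => [|q IHq]; elim=> [|n IHn].
- by rewrite /= big_nil.
(* Pascal's rule leaves the increment [n.+1], congruent to the new summand [n.+1 ^ p] by Fermat. *)
- rewrite !addn0 in IHn *; rewrite binS bin1 /= big_nat_recr //=.
  by rewrite -modnDm IHn fermat_little // modnDm.
- by rewrite /= big_nil bin_small.
(* The two Pascal terms match [IHn] (the sum up to [n]) and [IHq] at [n.+1] (the last summand), up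
   to shifting successors in the upper index. *)
- rewrite binS /= big_nat_recr //= -modnDm IHn IHq modnDm.
  by rewrite !addSn !addnS.
Qed.
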